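(* For each positive integer $n$, let $d_n$ be a positive integer, $f_n:\mathbb{R}^{d_n}\to\mathbb{R}$, $Z_n=\int_{\mathbb{R}^{d_n}}\exp(-nf_n(\theta))\,d\theta$, and let $\pi_n(\theta)=Z_n^{-1}\exp(-nf_n(\theta))$ be the target density on $\mathbb{R}^{d_n}$. Suppose there exists at least one $\theta_n^*$ which maximizes $\pi_n$ for each $n$. Assume for some $\kappa\in(0,1)$ the dimension satisfies $d_n\le n^\kappa$ and that the following holds for some constants $\delta_0,\lambda_0,f^*,I_0\in(0,\infty)$ (not depending on $n$) and for all sufficiently large $n$: 1. $f_n$ is $\lambda_0^{-1}$-strongly convex on $\{\theta:\|\theta-\theta_n^*\|_2\le\delta_0\}$. 2. The optimal point satisfies the strict optimality condition: $\displaystyle\inf_{\|v\|_2>\delta_0}f_n(\theta_n^*+v)\ge f_n(\theta_n^* )+f^*$. 3. The integral is controlled away from the optimum: $\displaystyle\int_{\|v\|_2>\delta_0}\exp\left(-\left(f_n(\theta_n^*+v)-f_n(\theta_n^* )\right)\right)dv\le(I_0n)^{d_n}$. Then for any $c\in(0,1]$, for all sufficiently large $n$, the density $\pi_n$ concentrates at $\theta_n^*$ with $$\pi_n(\theta_n^* )\ \ge\ \frac{1}{1+c}\left(\frac{n}{2\pi\lambda_0}\right)^{d_n/2}.$$ Moreover, for the Metropolis-Hastings algorithm targeting $\pi_n$, if the proposal density is bounded so that there is $B<\infty$, with $B$ possibly depending on $n$ or $d_n$, such that $q(\theta',\theta)\le B$ for all $\theta',\theta$, then $$A(\theta_n^*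 )\ \le\ B(1+c)\left(\frac{2\pi\lambda_0}{n}\right)^{d_n/2}.$$
   Context: In $2\pi\lambda_0$, $\pi$ is the usual constant. For a convex set $S$, a function $f$ is $\xi^{-1}$-strongly convex on $S$ if $\theta\mapsto f(\theta)-\|\theta\|_2^2/(2\xi)$ is convex on $S$. With $q(\theta,\cdot)$ the proposal density (with respect to Lebesgue measure) at state $\theta$, the Metropolis-Hastings acceptance function is $a(\theta,\theta')=\frac{\pi_n(\theta')q(\theta',\theta)}{\pi_n(\theta)q(\theta,\theta')}\wedge1$ if $\pi_n(\theta)q(\theta,\theta')>0$ and $a(\theta,\theta')=1$ otherwise, and the acceptance probability is $A(\theta)=\int a(\theta,\theta')q(\theta,\theta')\,d\theta'$. *)

(* Defs.v *)
From HB Require Import structures.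
From mathcomp Require Import all_boot all_order all_algebra.
From mathcomp Require Import all_classical all_reals all_analysis.

Set Implicit Arguments.
Unset Strict Implicit.
Unset Printing Implicit Defensive.

Import Order.TTheory GRing.Theory Num.Theory.
Import numFieldNormedType.Exports.

Local Open Scope classical_set_scope.
Local Open Scope ring_scope.

Definition rV_display : measure_display.
Proof. exact: default_measure_display. Qed.

(* 'rV[R]_n carries the product sigma-algebra generated by its coordinate
   functions, as n.-tuple R does in the library; it is the Borel one. *)
Section measurable_rV.
Context {R : realType}.

Definition coords n (i : 'I_n) (v : 'rV[R]_n) : R := v ord0 i.

Variable n : nat.

Let rV_set0 : g_sigma_preimage (@coords n) set0.
Proof. exact: sigma_algebra0. Qed.

Let rV_setC A :
  g_sigma_preimage (@coords n) A -> g_sigma_preimage (@coords n) (~` A).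
Proof. exact: sigma_algebraC. Qed.

Let rV_bigcup (F : _^nat) : (forall i, g_sigma_preimage (@coords n) (F i)) ->
  g_sigma_preimage (@coords n) (\bigcup_i (F i)).
Proof. exact: sigma_algebra_bigcup. Qed.

HB.instance Definition _ :=
  @isMeasurable.Build rV_display 'rV[R]_n
  (g_sigma_preimage (@coords n)) rV_set0 rV_setC rV_bigcup.

End measurable_rV.

Section measurable_rV_lemmas.
Context {R : realType}.

Lemma measurable_coord n (i : 'I_n) :
  measurable_fun [set: 'rV[R]_n] (fun v : 'rV[R]_n => v ord0 i).
Proof.
move=> _ Y mY; rewrite setTI; apply: sub_sigma_algebra => /=.
rewrite -bigcup_seq/=; exists i => /=; first by rewrite mem_index_enum.
by exists Y => //; rewrite setTI.
Qed.

Lemma measurable_fun_rV d (T : measurableType d) n (f : T -> 'rV[R]_n) :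
  (forall i, measurable_fun [set: T] (fun x => f x ord0 i)) ->
  measurable_fun [set: T] f.
Proof.
move=> mf _ A mA; rewrite setTI.
suff H : preimage_set_system [set: T] f (g_sigma_preimage (@coords R n))
    `<=` measurable.
  by apply: H; exists A => //; rewrite setTI.
rewrite -g_sigma_preimage_comp; apply: smallest_sub.
  exact: sigma_algebra_measurable.
rewrite -bigcup_seq/=; apply: bigcup_sub => i _ _ [B mB <-].
exact: (mf i).
Qed.

Definition rV_cons n (p : R * 'rV[R]_n) : 'rV[R]_n.+1 :=
  row_mx (const_mx p.1) p.2 : 'rV[R]_(1 + n).

Definition rV_uncons n (v : 'rV[R]_n.+1) : R * 'rV[R]_n :=
  (v ord0 ord0, rsubmx (v : 'rV[R]_(1 + n))).

Lemma rV_cons0 n p : @rV_cons n p ord0 ord0 = p.1.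
Proof. by rewrite mxE; case: splitP => [j _|//]; rewrite mxE. Qed.

Lemma rV_consS n p i : @rV_cons n p ord0 (lift ord0 i) = p.2 ord0 i.
Proof.
rewrite mxE; case: splitP => [j|j /= /eqP]; first by rewrite ord1.
by rewrite eqSS => /eqP ij; congr (p.2 _ _); exact: val_inj.
Qed.

Lemma rV_uncons2 n (v : 'rV[R]_n.+1) i :
  (rV_uncons v).2 ord0 i = v ord0 (lift ord0 i).
Proof. by rewrite mxE; congr (v _ _); exact: val_inj. Qed.

Lemma rV_consK n : cancel (@rV_cons n) (@rV_uncons n).
Proof.
move=> [x v]; rewrite [LHS]surjective_pairing; congr pair; first exact: rV_cons0.
by apply/rowP => i; rewrite rV_uncons2 rV_consS.
Qed.

Lemma rV_unconsK n : cancel (@rV_uncons n) (@rV_cons n).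
Proof.
move=> v; apply/rowP => i; case: (unliftP ord0 i) => [j|] ->.
  by rewrite rV_consS rV_uncons2.
by rewrite rV_cons0.
Qed.

Lemma measurable_rV_cons n : measurable_fun [set: _] (@rV_cons n).
Proof.
apply: measurable_fun_rV => i; case: (unliftP ord0 i) => [j|] ->.
  under eq_fun do rewrite rV_consS.
  exact: (measurableT_comp (measurable_coord j) measurable_snd).
by under eq_fun do rewrite rV_cons0; exact: measurable_fst.
Qed.

Lemma measurable_rV_uncons n : measurable_fun [set: _] (@rV_uncons n).
Proof.
apply: measurable_fun_pair; first exact: measurable_coord.
apply: measurable_fun_rV => i; under eq_fun do rewrite rV_uncons2.
exact: measurable_coord.
Qed.

End measurable_rV_lemmas.

Section lebesgue_rV.
Context {R : realType}.

Section step.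
Variables (n : nat) (mu : {sigma_finite_measure set 'rV[R]_n -> \bar R}).

Definition rV_step : set 'rV[R]_n.+1 -> \bar R :=
  pushforward (lebesgue_measure \x mu)%E (@rV_cons R n).


Let pm : {measure set 'rV[R]_n.+1 -> \bar R} :=
  measure_function_pushforward__canonical__measure_function_Measure
    (lebesgue_measure \x mu)%E (@measurable_rV_cons R n).

HB.instance Definition _ := isMeasure.Build _ _ _ rV_step
  (@measure0 _ _ _ pm) (@measure_ge0 _ _ _ pm)
  (@measure_semi_sigma_additive _ _ _ pm).

Let rV_step_sigma_finite : sigma_finite setT rV_step.
Proof.
have /sigma_finiteP[F [TF ndF Foo]] := sigma_finiteT (@lebesgue_measure R).
have /sigma_finiteP[G [TG ndG Goo]] := sigma_finiteT mu.
have mFG k : measurable (F k `*` G k).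
  by apply: measurableX; [case: (Foo k)|case: (Goo k)].
have uK A : @rV_cons R n @^-1` (@rV_uncons R n @^-1` A) = A.
  by rewrite -comp_preimage; apply/seteqP; split => p; rewrite /= rV_consK.
exists (fun k => @rV_uncons R n @^-1` (F k `*` G k)).
  rewrite -preimage_bigcup; apply/esym; rewrite -subTset => v _.
  have [i _ Fi] : (\bigcup_i F i) (rV_uncons v).1 by rewrite -TF.
  have [j _ Gj] : (\bigcup_i G i) (rV_uncons v).2 by rewrite -TG.
  exists (maxn i j) => //; split.
    by move: Fi; exact/subsetPset/ndF/leq_maxl.
  by move: Gj; exact/subsetPset/ndG/leq_maxr.
move=> k; split.
  by have := @measurable_rV_uncons R n measurableT _ (mFG k); rewrite setTI.
have [mF Foo_k] := Foo k; have [mG Goo_k] := Goo k.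
rewrite /rV_step /pushforward uK product_measure1E//.
by rewrite lte_mul_pinfty// ge0_fin_numE.
Qed.

HB.instance Definition _ :=
  Measure_isSigmaFinite.Build _ _ _ rV_step rV_step_sigma_finite.

End step.

(* Lebesgue measure on R^n: the n-fold product of lebesgue_measure, built by
   R^n.+1 = R * R^n; see lebesgue_rV_box for its value on boxes. *)
Fixpoint lebesgue_rV n : {sigma_finite_measure set 'rV[R]_n -> \bar R} :=
  match n return {sigma_finite_measure set 'rV[R]_n -> \bar R} with
  | 0%N => dirac (0 : 'rV[R]_0)
  | k.+1 => rV_step (lebesgue_rV k)
  end.

Lemma lebesgue_rV_box n (A : 'I_n -> set R) : (forall i, measurable (A i)) ->
  lebesgue_rV n [set v | forall i, A i (v ord0 i)] =
  (\prod_(i < n) lebesgue_measure (A i))%E.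
Proof.
elim: n A => [|n IH] A mA.
  by rewrite big_ord0 /= diracE (_ : _ \in _) // inE => -[].
pose B := [set v : 'rV[R]_n | forall i, A (lift ord0 i) (v ord0 i)].
have mB : measurable B.
  rewrite (_ : B = \bigcap_(i in [set: 'I_n])
      ((fun v : 'rV[R]_n => v ord0 i) @^-1` A (lift ord0 i))).
    apply: fin_bigcap_measurable => // i _.
    by rewrite -[X in measurable X]setTI; exact: measurable_coord.
  by apply/seteqP; split => v /= Bv i; [move=> _; exact: Bv|exact: Bv].
rewrite big_ord_recl -IH//= /rV_step /pushforward.
rewrite -product_measure1E//; last exact: mA.
congr (_ _); apply/seteqP; split => -[x v] /=.
  move=> Av; split => /=; first by have := Av ord0; rewrite rV_cons0.
  by move=> i; have := Av (lift ord0 i); rewrite rV_consS.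
move=> [/= Ax Bv] i; case: (unliftP ord0 i) => [j|] ->.
  by rewrite rV_consS; exact: Bv.
by rewrite rV_cons0.
Qed.

End lebesgue_rV.

Section definitions.
Context {R : realType}.

(* The library's norm `|v| on 'rV[R]_n is the sup norm. *)
Definition norm2 n (v : 'rV[R]_n) : R := Num.sqrt (\sum_(i < n) v ord0 i ^+ 2).

Definition inv_strongly_convex n (xi : R) (S : set 'rV[R]_n)
    (f : 'rV[R]_n -> R) : Prop :=
  convex_function (S : set (convex_lmodType 'rV[R]_n))
    (fun theta => f theta - norm2 theta ^+ 2 / (2 * xi) : R^o).

Definition is_density n (p : 'rV[R]_n -> R) : Prop :=
  [/\ measurable_fun [set: 'rV[R]_n] p, (forall theta, 0 <= p theta) &
      (\int[lebesgue_rV n]_theta (p theta)%:E = 1)%E].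

Definition partition_fun (n : nat) d (f : 'rV[R]_d -> R) : \bar R :=
  (\int[lebesgue_rV d]_theta (expR (- (n%:R * f theta)))%:E)%E.

(* This is the constant 0, hence not a density, when partition_fun n f = +oo. *)
Definition target (n : nat) d (f : 'rV[R]_d -> R) (theta : 'rV[R]_d) : R :=
  (fine (partition_fun n f))^-1 * expR (- (n%:R * f theta)).

Definition mh_acceptance d (p : 'rV[R]_d -> R) (q : 'rV[R]_d -> 'rV[R]_d -> R)
    (theta theta' : 'rV[R]_d) : R :=
  if 0 < p theta * q theta theta' then
    Num.min (p theta' * q theta' theta / (p theta * q theta theta')) 1
  else 1.

(* If q is measurable in its second argument only, the integrand may fail to be
   measurable; the integral is then the supremum of the integrals of the
   nonnegative simple functions below it. *)
Definition mh_acceptance_probability d (p : 'rV[R]_d -> R)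
    (q : 'rV[R]_d -> 'rV[R]_d -> R) (theta : 'rV[R]_d) : \bar R :=
  (\int[lebesgue_rV d]_theta'
    (mh_acceptance p q theta theta' * q theta theta')%:E)%E.

End definitions.

(* Main.v *)
Require Import Defs.
From HB Require Import structures.
From mathcomp Require Import all_boot all_order all_algebra.
From mathcomp Require Import all_classical all_reals all_analysis.
From mathcomp Require Import measurable_realfun.
From mathcomp Require Import ring lra.

(** The proof is Laplace's method with explicit constants.  Write x for the
    mode, g v = f (x + v) - f x and J for the integral of exp (- n g).  By
    translation invariance of Lebesgue measure, J is exp (n f x) times the
    partition function, hence [target n f x = 1 / J] (integral_shifted_energy),
    so that everything reduces to the bound [J <= (1 + c) P] with
    P = (2 pi lambda0 / n) ^ (d / 2).

    On the ball of radius delta0, strong convexity together with minimality of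
    f at x gives [g v >= |v|^2 / (2 lambda0)] (strong_convexity_growth).  The
    ball thus contributes at most the integral of a Gaussian over the whole
    space, which is exactly P (integral_gauss_rV).  Outside the ball, g >= fs
    gives exp (- n g) <= exp (- (n - 1) fs) exp (- g), and the assumed control
    of the integral of exp (- g) bounds the contribution by
    exp (- (n - 1) fs) (I0 n) ^ d.  Since d <= n ^ kappa with kappa < 1, the
    quantities ln ((I0 n) ^ d) and ln (1 / P) are both O (n ^ kappa ln n), hence
    o (n), so this contribution is eventually at most c P (tail_negligible).

    For the chain at x, the definition of the acceptance function gives
    a (x, y) q (x, y) <= p y q (y, x) / p x <= (B / p x) p y, where p is the
    target density; integrating in y yields A (x) <= B / p x
    (acceptance_probability_le). *)

Set Implicit Arguments.
Unset Strict Implicit.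
Unset Printing Implicit Defensive.

Import Order.TTheory GRing.Theory Num.Theory.
Import numFieldNormedType.Exports.

Local Open Scope classical_set_scope.
Local Open Scope ring_scope.

(** * Lebesgue measure and Gaussian integrals on R^n *)

Section lebesgue_rV_integral.
Context {R : realType}.
Local Open Scope ereal_scope.

(** The integral of a nonnegative function is a supremum over the simple
    functions below it.  The acceptance probability calls for this generality:
    its integrand contains y |-> q y x, which may fail to be measurable. *)
Lemma le_integral_ge0 d (T : measurableType d)
    (mu : {measure set T -> \bar R}) (D : set T) (g h : T -> \bar R) :
  (forall x, D x -> 0 <= g x) -> (forall x, D x -> g x <= h x) ->
  \int[mu]_(x in D) g x <= \int[mu]_(x in D) h x.
Proof.
move=> g0 gh; rewrite !ge0_integralE//; last first.
  by move=> x Dx; exact: le_trans (g0 x Dx) (gh x Dx).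
apply: ereal_sup_le => _ [s /= sg <-]; exists s => //= x.
apply: le_trans (sg x) _; rewrite /patch; case: ifPn => //.
by rewrite inE; exact: gh.
Qed.

(** Tonelli for R^(n+1) = R * R^n: the induction step behind every
    computation with [lebesgue_rV] below. *)
Lemma ge0_integral_rVS n (g : 'rV[R]_n.+1 -> \bar R) :
  measurable_fun [set: 'rV[R]_n.+1] g -> (forall v, 0 <= g v) ->
  \int[lebesgue_rV n.+1]_v g v =
  \int[lebesgue_measure]_x \int[lebesgue_rV n]_v g (rV_cons (x, v)).
Proof.
move=> mg g0.
transitivity (\int[lebesgue_measure \x lebesgue_rV n]_p g (rV_cons p)).
  (* The source type is given explicitly so that R carries the sigma-algebra on
     which lebesgue_measure is defined. *)
  have pushE := fun mphi => @ge0_integral_pushforward _ _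
    (measurableTypeR R * 'rV[R]_n)%type 'rV[R]_n.+1 R (@rV_cons R n) mphi
    (lebesgue_measure \x lebesgue_rV n) setT g.
  have := pushE (@measurable_rV_cons R n) measurableT mg.
  rewrite preimage_setT; apply.
  by move=> v _; apply: g0.
rewrite fubini_tonelli1//.
exact: measurableT_comp mg (@measurable_rV_cons R n).
Qed.

Lemma measurable_ge0_integral_rVS n (g : 'rV[R]_n.+1 -> \bar R) :
  measurable_fun [set: 'rV[R]_n.+1] g -> (forall v, 0 <= g v) ->
  measurable_fun [set: R] (fun x => \int[lebesgue_rV n]_v g (rV_cons (x, v))).
Proof.
move=> mg g0.
apply: (@measurable_fun_fubini_tonelli_F _ _ _ _ _ (lebesgue_rV n)
  (g \o @rV_cons R n)).
  exact: measurableT_comp mg (@measurable_rV_cons R n).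
by move=> x; exact: g0.
Qed.

Lemma measurable_rV_cons2 n (x : R) :
  measurable_fun [set: 'rV[R]_n] (fun v => rV_cons (x, v)).
Proof.
apply: measurableT_comp (@measurable_rV_cons R n) _.
exact: pair1_measurable.
Qed.

(** By uniqueness of Lebesgue measure, it is enough to compare the two
    measures on half-open intervals. *)
Lemma lebesgue_measure_shift (a : R) (A : set R) : measurable A ->
  pushforward lebesgue_measure
    ((fun x => a + x)%R : measurableTypeR R -> measurableTypeR R) A =
  lebesgue_measure A.
Proof.
have ma : measurable_fun setT
    ((fun x => a + x)%R : measurableTypeR R -> measurableTypeR R).
  exact: measurable_funD.
pose pm : {measure set (measurableTypeR R) -> \bar R} :=
  measure_function_pushforward__canonical__measure_function_Measure
    lebesgue_measure ma.
move=> mA; apply/esym.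
apply: (@lebesgue_measure_unique R pm) => // _ [[b c] _ <-].
have -> : pm `]b, c]%classic =
    lebesgue_measure (`](b - a)%R, (c - a)%R]%classic : set R).
  rewrite /pm/= /pushforward; congr lebesgue_measure.
  by apply/seteqP; split => x /=; rewrite !in_itv/= ltrBlDl lerBrDl.
rewrite !lebesgue_measure_itv/= !lte_fin ltrD2r.
by case: ifP => // _; rewrite -!EFinD opprB addrA subrK.
Qed.

Lemma ge0_integral_shift (a : R) (g : R -> \bar R) :
  measurable_fun setT g -> (forall x, 0 <= g x) ->
  \int[lebesgue_measure]_x g (a + x)%R = \int[lebesgue_measure]_x g x.
Proof.
move=> mg g0.
have ma : measurable_fun setT
    ((fun x => a + x)%R : measurableTypeR R -> measurableTypeR R).
  exact: measurable_funD.
transitivity (\int[pushforward lebesgue_measure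
    ((fun x => a + x)%R : measurableTypeR R -> measurableTypeR R)]_x g x).
  by rewrite (ge0_integral_pushforward ma)// preimage_setT.
pose pm : {measure set (measurableTypeR R) -> \bar R} :=
  measure_function_pushforward__canonical__measure_function_Measure
    lebesgue_measure ma.
apply: (@eq_measure_integral _ _ _ _ _ pm) => A mA _.
exact: lebesgue_measure_shift.
Qed.

Lemma rV_consD n (x y : R) (u v : 'rV[R]_n) :
  (rV_cons (x, u) + rV_cons (y, v) = rV_cons ((x + y)%R, (u + v)%R))%R.
Proof.
apply/rowP => i; rewrite mxE; case: (unliftP ord0 i) => [j|] ->.
  by rewrite !rV_consS mxE.
by rewrite !rV_cons0.
Qed.

Lemma ge0_integral_rV_shift n (a : 'rV[R]_n) (g : 'rV[R]_n -> \bar R) :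
  measurable_fun [set: 'rV[R]_n] g -> (forall v, 0 <= g v) ->
  \int[lebesgue_rV n]_v g (a + v)%R = \int[lebesgue_rV n]_v g v.
Proof.
elim: n a g => [|n IH] a g mg g0.
  by apply: eq_integral => v _; congr g; apply/rowP => -[].
have mga : measurable_fun [set: 'rV[R]_n.+1] (fun v => g (a + v)%R).
  apply: measurableT_comp mg _; apply: measurable_fun_rV => i.
  under eq_fun do rewrite mxE.
  by apply: measurable_funD; [exact: measurable_cst|exact: measurable_coord].
rewrite (ge0_integral_rVS mga (fun v => g0 _)) (ge0_integral_rVS mg g0).
rewrite -[in LHS](rV_unconsK a); case: (rV_uncons a) => b u.
rewrite -[RHS](ge0_integral_shift b (measurable_ge0_integral_rVS mg g0)).
- apply: eq_integral => x _; under eq_integral do rewrite rV_consD.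
  apply: (IH u (fun w => g (rV_cons ((b + x)%R, w)))) => //.
  exact: measurableT_comp mg (measurable_rV_cons2 _).
- by move=> x; apply: integral_ge0 => v _; exact: g0.
Qed.

(** The normal density of mean 0 and variance 1 / (2 b) has total mass 1;
    the integral is the inverse of its peak value. *)
Lemma integral_gauss (b : R) : (0 < b)%R ->
  \int[lebesgue_measure]_x (expR (- (b * x ^+ 2)))%:E = (Num.sqrt (pi / b))%:E.
Proof.
move=> b0; set s := Num.sqrt (2 * b)^-1.
have s0 : s != 0%R by rewrite gt_eqF// sqrtr_gt0 invr_gt0 mulr_gt0.
have s2 : (s ^+ 2 = (2 * b)^-1)%R.
  by rewrite sqr_sqrtr// invr_ge0 mulr_ge0// ltW.
have peak : ((normal_peak s)^-1 = Num.sqrt (pi / b))%R.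
  rewrite /normal_peak invrK s2; congr Num.sqrt.
  by rewrite -mulr_natr; field; rewrite gt_eqF.
have peak0 : (0 < Num.sqrt (pi / b))%R by rewrite sqrtr_gt0 divr_gt0// pi_gt0.
have : (Num.sqrt (pi / b))%:E * \int[lebesgue_measure]_x (normal_pdf 0 s x)%:E =
    (Num.sqrt (pi / b))%:E by rewrite integral_normal_pdf mule1.
have mpdf : measurable_fun [set: R] (fun x => (normal_pdf 0 s x)%:E).
  by apply/measurable_EFinP; exact: measurable_normal_pdf.
rewrite -ge0_integralZl//; last first.
  by move=> x _; rewrite lee_fin normal_pdf_ge0.
move=> <-; apply: eq_integral => x _; rewrite -EFinM; congr EFin.
have -> : normal_pdf 0 s x = (normal_peak s * normal_fun 0 s x)%R.
  by rewrite normal_pdfE.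
rewrite -peak mulKf ?gt_eqF ?normal_peak_gt0// /normal_fun.
by congr expR; rewrite s2 subr0 -mulr_natr; field; rewrite gt_eqF.
Qed.

Lemma norm2_sqr n (v : 'rV[R]_n) :
  (norm2 v ^+ 2 = \sum_(i < n) v ord0 i ^+ 2)%R.
Proof. by rewrite sqr_sqrtr// sumr_ge0// => i _; exact: sqr_ge0. Qed.

Lemma measurable_norm2_sqr n :
  measurable_fun [set: 'rV[R]_n] (fun v => norm2 v ^+ 2)%R.
Proof.
under eq_fun do rewrite norm2_sqr.
by apply: measurable_sum => i; apply: measurable_funX; exact: measurable_coord.
Qed.

(** The integrand is the product over the coordinates of one-dimensional
    Gaussians, hence the n-th power of sqrt (pi / b). *)
Lemma integral_gauss_rV n (b : R) : (0 < b)%R ->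
  \int[lebesgue_rV n]_v (expR (- (b * norm2 v ^+ 2)))%:E =
  ((pi / b) `^ (n%:R / 2))%:E.
Proof.
move=> b0; have pib : (0 <= pi / b)%R by rewrite divr_ge0 ?pi_ge0// ltW.
rewrite powRrM (powRAC _ n%:R) powR12_sqrt// powR_mulrn//.
have mG m : measurable_fun [set: 'rV[R]_m]
    (fun v => (expR (- (b * norm2 v ^+ 2)))%:E).
  apply/measurable_EFinP; apply: measurableT_comp => //.
  apply: measurableT_comp => //; apply: measurable_funM => //.
  exact: measurable_norm2_sqr.
elim: n => [|n IH].
  rewrite [LHS](integral_dirac _ measurableT (mG 0%N)) diracT mul1e.
  rewrite norm2_sqr big_ord0 mulr0 oppr0.
  by rewrite expR0 expr0.
rewrite (ge0_integral_rVS (mG n.+1) (fun v => expR_ge0 _)).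
transitivity (\int[lebesgue_measure]_x
    ((Num.sqrt (pi / b) ^+ n)%:E * (expR (- (b * x ^+ 2)))%:E)).
  apply: eq_integral => x _; rewrite -IH muleC.
  rewrite -(ge0_integralZl _ measurableT (mG n))//.
  apply: eq_integral => v _; rewrite -EFinM -expRD -opprD -mulrDr.
  rewrite !norm2_sqr big_ord_recl rV_cons0; congr (expR (- (b * (_ + _))))%:E.
  by apply: eq_bigr => i _; rewrite rV_consS.
have mg : measurable_fun [set: R] (fun x => (expR (- (b * x ^+ 2)))%:E).
  apply/measurable_EFinP; apply: measurableT_comp => //.
  by apply: measurableT_comp => //; apply: measurable_funM.
rewrite ge0_integralZl//.
by rewrite integral_gauss// -EFinM -exprSr.
Qed.

End lebesgue_rV_integral.

(** * Quadratic growth at a minimum *)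

Section quadratic_growth.
Context {R : realType}.

Lemma norm2_sqr_segment n (t : R) (x v : 'rV[R]_n) :
  norm2 (x + t *: v) ^+ 2 =
  t * norm2 (x + v) ^+ 2 + (1 - t) * norm2 x ^+ 2 - t * (1 - t) * norm2 v ^+ 2.
Proof.
rewrite !norm2_sqr !mulr_sumr -big_split -sumrB /=; apply: eq_bigr => i _.
by rewrite !mxE; ring.
Qed.

(** Strong convexity on the segment from x to x + v, at parameter t, and
    f x <= f (x + t v) give (1 - t) |v|^2 / (2 xi) <= f (x + v) - f x for every
    t in (0, 1]; let t tend to 0. *)
Lemma strong_convexity_growth n (xi delta : R) (f : 'rV[R]_n -> R)
    (x : 'rV[R]_n) : 0 <= delta ->
  inv_strongly_convex xi [set theta | norm2 (theta - x) <= delta] f ->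
  (forall theta, f x <= f theta) ->
  forall v, norm2 v <= delta -> norm2 v ^+ 2 / (2 * xi) <= f (x + v) - f x.
Proof.
move=> delta0 fcvx xmin v vdelta.
set y := norm2 v ^+ 2 / (2 * xi); set G := f (x + v) - f x.
have G0 : 0 <= G by rewrite subr_ge0.
have xS : (x : convex_lmodType 'rV[R]_n)
    \in ([set theta | norm2 (theta - x) <= delta] : set (convex_lmodType _)).
  rewrite inE /= subrr /norm2 big1 ?sqrtr0// => i _.
  by rewrite mxE expr0n.
have xvS : (x + v : convex_lmodType 'rV[R]_n)
    \in ([set theta | norm2 (theta - x) <= delta] : set (convex_lmodType _)).
  by rewrite inE /= addrC addKr.
have bound (t : R) : 0 < t -> t <= 1 -> (1 - t) * y <= G.
  move=> t0 t1; have := fcvx (Itv01 (ltW t0) t1) _ _ xvS xS.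
  rewrite convRE /conv/= /unstable.onem.
  have -> : t *: (x + v) + (1 - t) *: x = x + t *: v.
    by apply/rowP => i; rewrite !mxE; ring.
  rewrite norm2_sqr_segment => cvx.
  rewrite -(ler_pM2l t0); have := xmin (x + t *: v); rewrite /G /y.
  move: cvx; set a := norm2 (x + v) ^+ 2; set b := norm2 x ^+ 2.
  set w := norm2 v ^+ 2; rewrite !mulrBr !mulrDl !mulrA.
  set k := (2 * xi)^-1; lra.
clearbody y G; rewrite leNgt; apply/negP => Gy.
have y0 : 0 < y by exact: le_lt_trans G0 Gy.
(* At this t the left-hand side of the bound is (y + G) / 2, which exceeds G. *)
have := bound ((y - G) / (2 * y)); rewrite divr_gt0 ?subr_gt0 ?mulr_gt0//.
rewrite ler_pdivrMr ?mulr_gt0// => /(_ isT).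
have -> : (1 - (y - G) / (2 * y)) * y = (y + G) / 2 by field; rewrite gt_eqF.
have le2 : y - G <= 1 * (2 * y) by lra.
by move=> /(_ le2); lra.
Qed.

End quadratic_growth.

(** * Asymptotics of the tail *)

Section tail.
Context {R : realType}.

Lemma powR_cvgy (e M : R) : 0 < e -> \forall n \near \oo, M <= n%:R `^ e.
Proof.
move=> e0; near=> n; have M0 : 0 <= `|M| `^ e^-1 by exact: powR_ge0.
apply: le_trans (ler_norm M) _.
have eN0 : e != 0 by rewrite gt_eqF.
rewrite -(powRr1 (normr_ge0 M)) -[X in _ `^ X <= _](mulVf eN0) powRrM.
rewrite ge0_ler_powR ?nnegrE ?(ltW e0)//.
by near: n; exact: nbhs_infty_ger.
Unshelve. all: by end_near. Qed.

(** Moved to the left, the power on the right makes a product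
    (I n) ^ d (n / (2 pi lambda)) ^ (d / 2), which is at most n ^ (2 d) once n
    absorbs the constants.  Its logarithm 2 d ln n <= 2 n ^ kappa ln n is o (n),
    while the exponential decays at a linear rate. *)
Lemma tail_negligible (kappa lambda s I c : R) (d : nat -> nat) :
  kappa < 1 -> 0 < lambda -> 0 < s -> 0 < I -> 0 < c ->
  (forall n, (0 < n)%N -> (d n)%:R <= n%:R `^ kappa) ->
  \forall n \near \oo,
    expR (- ((n%:R - 1) * s)) * (I * n%:R) ^+ d n
      <= c * (2 * pi * lambda / n%:R) `^ ((d n)%:R / 2).
Proof.
move=> k1 l0 s0 I0 c0 d_le; have pi0 := @pi_gt0 R.
(* kappa + 2 e = 1: one factor n ^ e absorbs ln n and the other one beats the
   remaining constant. *)
pose e := (1 - kappa) / 2; have e0 : 0 < e by rewrite divr_gt0// subr_gt0.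
near=> n; have n0 : (0 < n)%N by near: n; exact: nbhs_infty_gt.
have nR0 : 0 < n%:R :> R by rewrite ltr0n.
have dle := d_le n n0; have pl0 : 0 < 2 * pi * lambda by rewrite !mulr_gt0.
have D0 : 0 <= (d n)%:R :> R by [].
have lnn : 0 <= ln n%:R :> R by rewrite ln_ge0// ler1n.
have base : ln I + ln n%:R + (ln n%:R - ln (2 * pi * lambda)) / 2
    <= 2 * ln n%:R :> R.
  have : 2 * ln I - ln (2 * pi * lambda) <= ln n%:R.
    rewrite -ler_expR lnK ?posrE//; near: n; exact: nbhs_infty_ger.
  lra.
have lnbound : ln n%:R <= n%:R `^ e / e.
  rewrite ler_pdivlMr// mulrC -ln_powR; apply/ltW/ln_sublinear.
  exact: powR_gt0.
have main : (d n)%:R * (2 * ln n%:R) <= n%:R * s / 2.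
  have h1 : (d n)%:R * (2 * ln n%:R) <= n%:R `^ kappa * (2 * (n%:R `^ e / e)).
    by apply: ler_pM => //; [rewrite mulr_ge0|rewrite ler_pM2l].
  apply: le_trans h1 _.
  have split_n : n%:R `^ kappa * n%:R `^ e * n%:R `^ e = n%:R :> R.
    rewrite -!powRD ?(gt_eqF nR0) ?implybT// -[RHS]powRr1 ?ltW//.
    by congr (_ `^ _); rewrite /e; lra.
  have big : 4 / (e * s) <= n%:R `^ e :> R by near: n; exact: powR_cvgy.
  rewrite -[X in _ <= X * s / 2]split_n; set A := n%:R `^ kappa * n%:R `^ e.
  have A0 : 0 <= A by rewrite mulr_ge0// powR_ge0.
  have -> : n%:R `^ kappa * (2 * (n%:R `^ e / e)) = A * (4 / (e * s) * s / 2).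
    by rewrite /A; field; rewrite !gt_eqF.
  clearbody A; rewrite !mulrA !ler_pM2r ?invr_gt0// -mulrA.
  exact: ler_wpM2l.
have const : s - ln c <= n%:R * s / 2.
  have : (s - ln c) * (2 / s) <= n%:R by near: n; exact: nbhs_infty_ger.
  by rewrite mulrA ler_pdivrMr//; lra.
set P := 2 * pi * lambda in pl0 base *; clearbody P.
rewrite -[leLHS]lnK ?posrE ?mulr_gt0 ?expR_gt0 ?exprn_gt0 ?mulr_gt0//.
rewrite -[leRHS]lnK ?posrE ?mulr_gt0 ?powR_gt0 ?divr_gt0//.
rewrite ler_expR !lnM ?posrE ?powR_gt0 ?expR_gt0
  ?exprn_gt0 ?mulr_gt0 ?invr_gt0//.
rewrite expRK lnXn ?mulr_gt0// ln_powR ln_div ?posrE// lnM ?posrE//.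
rewrite -[_ *+ d n]mulr_natl.
have := ler_wpM2l D0 base.
set L := ln n%:R in main const *; lra.
Unshelve. all: by end_near. Qed.

End tail.

(** * Laplace's method *)

Section laplace.
Context {R : realType}.
Local Open Scope ereal_scope.

Lemma measurable_norm2_gt n (delta : R) :
  measurable [set v : 'rV[R]_n | (delta < norm2 v)%R].
Proof.
have mnorm : measurable_fun [set: 'rV[R]_n] (@norm2 R n).
  have -> : @norm2 R n = (fun v => Num.sqrt (norm2 v ^+ 2)).
    by apply/funext => v; rewrite norm2_sqr.
  apply: measurableT_comp (@measurable_norm2_sqr R n).
  exact: continuous_measurable_fun (@sqrt_continuous R).
have -> : [set v : 'rV[R]_n | (delta < norm2 v)%R] =
    [set: 'rV[R]_n] `&` @norm2 R n @^-1` `]delta, +oo[%classic.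
  by rewrite setTI; apply/seteqP; split => v /=; rewrite in_itv/= andbT.
exact: mnorm (measurable_itv _).
Qed.

(** Laplace's upper bound, valid for every n.  On the tail, one copy of g
    is kept for integrability and the other n - 1 copies are bounded below
    by s. *)
Lemma laplace_integral_le n d (g : 'rV[R]_d -> R) (lambda delta s T : R) :
  (0 < n)%N -> (0 < lambda)%R -> measurable_fun [set: 'rV[R]_d] g ->
  (forall v, norm2 v <= delta -> norm2 v ^+ 2 / (2 * lambda) <= g v)%R ->
  (forall v, delta < norm2 v -> s <= g v)%R ->
  \int[lebesgue_rV d]_(v in [set v | (delta < norm2 v)%R]) (expR (- g v))%:E
    <= T%:E ->
  \int[lebesgue_rV d]_v (expR (- (n%:R * g v)))%:E <=
  ((2 * pi * lambda / n%:R) `^ (d%:R / 2) + expR (- ((n%:R - 1) * s)) * T)%:E.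
Proof.
move=> n0 l0 mg near_growth far_growth tail.
have nR0 : (0 < n%:R :> R)%R by rewrite ltr0n.
have n1 : (0 <= n%:R - 1 :> R)%R by rewrite subr_ge0 ler1n.
set D := [set v : 'rV[R]_d | (delta < norm2 v)%R]; have mD : measurable D.
  exact: measurable_norm2_gt.
have mexp (k : R) :
    measurable_fun [set: 'rV[R]_d] (fun v => (expR (- (k * g v)))%:E).
  apply/measurable_EFinP; apply: measurableT_comp => //.
  by apply: measurableT_comp => //; apply: measurable_funM.
rewrite -(setUv D) setUC ge0_integral_setU//; first last.
- by rewrite disj_set2E setICl.
- by rewrite setvU.
- exact: measurableC.
rewrite EFinD; apply: leeD.
  have b0 : (0 < n%:R / (2 * lambda) :> R)%R by rewrite divr_gt0// mulr_gt0.
  have -> : (2 * pi * lambda / n%:R = pi / (n%:R / (2 * lambda)) :> R)%R.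
    by field; rewrite !gt_eqF.
  rewrite -(integral_gauss_rV _ b0).
  apply: (@le_trans _ _ (\int[lebesgue_rV d]_(v in ~` D)
      (expR (- (n%:R / (2 * lambda) * norm2 v ^+ 2)))%:E)).
    apply: le_integral_ge0 => v Dv; first by rewrite lee_fin expR_ge0.
    rewrite lee_fin ler_expR lerN2 -mulrA ler_pM2l// mulrC near_growth//.
    by rewrite leNgt; apply/negP.
  apply: ge0_subset_integral => //; first exact: measurableC.
  apply/measurable_EFinP; apply: measurableT_comp => //.
  apply: measurableT_comp => //; apply: measurable_funM => //.
  exact: measurable_norm2_sqr.
rewrite EFinM; apply: (@le_trans _ _ (\int[lebesgue_rV d]_(v in D)
    ((expR (- ((n%:R - 1) * s)))%:E * (expR (- g v))%:E))).
  apply: le_integral_ge0 => v Dv; first by rewrite lee_fin expR_ge0.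
  rewrite -EFinM -expRD lee_fin ler_expR -opprD lerN2.
  rewrite -[leRHS](_ : (n%:R - 1) * g v + g v = _)%R; last by ring.
  by rewrite lerD2r ler_wpM2l// far_growth.
rewrite ge0_integralZl//; last first.
  apply: (@measurable_funS _ _ _ _ setT) => //.
  by have := mexp 1%R; under eq_fun do rewrite mul1r.
by apply: lee_wpmul2l => //; rewrite lee_fin expR_ge0.
Qed.

End laplace.

(** * The target density at a point *)

Section target.
Context {R : realType}.
Variables (n d : nat) (f : 'rV[R]_d -> R).
Hypotheses (n_gt0 : (0 < n)%N) (densf : is_density (target n f)).

(** A partition function equal to 0 or to +oo would make [target] the
    constant 0, which does not integrate to 1. *)
Lemma fine_partition_fun_gt0 : 0 < fine (partition_fun n f).
Proof.
rewrite lt_neqAle fine_ge0 ?andbT; last first.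
  by apply: integral_ge0 => v _; rewrite lee_fin expR_ge0.
apply/negP => /eqP Z0; have [_ _] := densf.
rewrite (_ : (fun theta => _) = cst 0%E); last first.
  by apply/funext => v; rewrite /target -Z0 invr0 mul0r.
by rewrite integral0 => /eqP; rewrite eqe eq_sym oner_eq0.
Qed.

Lemma partition_funK : ((fine (partition_fun n f))%:E = partition_fun n f)%E.
Proof.
by rewrite fineK//; have := fine_partition_fun_gt0; case: (partition_fun n f);
  rewrite //= ltxx.
Qed.

(** The energy is recovered from the measurable target by taking a
    logarithm. *)
Lemma measurable_energy : measurable_fun [set: 'rV[R]_d] f.
Proof.
have [mt _ _] := densf; have nR0 : 0 < n%:R :> R by rewrite ltr0n.
have -> : f = (fun v =>
    - n%:R^-1 * ln (fine (partition_fun n f) * target n f v)).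
  apply/funext => v; rewrite /target mulVKf ?gt_eqF ?fine_partition_fun_gt0//.
  by rewrite expRK; field; rewrite gt_eqF.
apply: measurable_funM => //; apply: measurableT_comp => //.
exact: measurable_funM.
Qed.

Lemma le_target x y : (target n f x <= target n f y) = (f y <= f x).
Proof.
rewrite /target ler_pM2l ?invr_gt0 ?fine_partition_fun_gt0//.
by rewrite ler_expR lerN2 ler_pM2l ?ltr0n.
Qed.

Lemma integral_shifted_energy x :
  (\int[lebesgue_rV d]_v (expR (- (n%:R * (f (x + v)%R - f x))))%:E =
   (target n f x)^-1%:E)%E.
Proof.
have mE : measurable_fun [set: 'rV[R]_d] (fun v => (expR (- (n%:R * f v)))%:E).
  apply/measurable_EFinP; apply: measurableT_comp => //.
  apply: measurableT_comp => //; apply: measurable_funM => //.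
  exact: measurable_energy.
pose h v := ((expR (n%:R * f x))%:E * (expR (- (n%:R * f v)))%:E)%E.
transitivity (\int[lebesgue_rV d]_v h (x + v)%R)%E.
  apply: eq_integral => v _; rewrite /h -EFinM -expRD; congr (expR _)%:E; ring.
rewrite ge0_integral_rV_shift; last 2 first.
- exact: emeasurable_funM.
- by move=> v; apply: mule_ge0; rewrite lee_fin expR_ge0.
rewrite ge0_integralZl//.
rewrite -/(partition_fun n f) -partition_funK -EFinM.
by rewrite /target invfM invrK expRN invrK mulrC.
Qed.

End target.

(** * Acceptance probability *)

(** When the ratio is defined, a (x, y) q (x, y) <= p y q (y, x) / p x; when
    it is not, q (x, y) = 0 because p x > 0.  In both cases the integrand is at
    most (B / p x) p y. *)
Lemma acceptance_probability_le (R : realType) d (p : 'rV[R]_d -> R)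
    (q : 'rV[R]_d -> 'rV[R]_d -> R) (B : R) x :
  is_density p -> 0 < p x -> (forall y z, 0 <= q y z) ->
  (forall y z, q y z <= B) ->
  (mh_acceptance_probability p q x <= (B / p x)%:E)%E.
Proof.
move=> [mp p0 p1] px q0 qB; have B0 : 0 <= B := le_trans (q0 x x) (qB x x).
have Bp0 : 0 <= B / p x by rewrite divr_ge0// ltW.
apply: (@le_trans _ _ (\int[lebesgue_rV d]_y ((B / p x)%:E * (p y)%:E))%E).
  apply: le_integral_ge0 => y _; rewrite ?lee_fin /mh_acceptance.
    apply: mulr_ge0 => //; case: ifPn => // _.
    by rewrite le_min ler01 andbT divr_ge0// mulr_ge0// ltW.
  case: ifPn => [pq|].
    have qxy : 0 < q x y by move: pq; rewrite pmulr_rgt0.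
    apply: (@le_trans _ _ (p y * q y x / (p x * q x y) * q x y)).
      by rewrite ler_wpM2r// ge_min lexx.
    have -> : p y * q y x / (p x * q x y) * q x y = q y x / p x * p y.
      by field; rewrite !gt_eqF.
    by rewrite ler_wpM2r// ler_pM2r ?invr_gt0.
  rewrite pmulr_rgt0// -leNgt => qxy; rewrite mul1r.
  by apply: le_trans qxy _; rewrite mulr_ge0.
rewrite ge0_integralZl ?p1 ?mule1//.
- exact/measurable_EFinP.
- by move=> y _; rewrite lee_fin.
Qed.

(** * Concentration at the mode *)

Theorem proposition6 (R : realType) (d : nat -> nat)
  (f : forall n : nat, 'rV[R]_(d n) -> R)
  (thetas : forall n : nat, 'rV[R]_(d n))
  (kappa delta0 lambda0 fs I0 : R)
  (d_gt0 : forall n : nat, (0 < n)%N -> (0 < d n)%N)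
  (target_density : forall n : nat, (0 < n)%N -> is_density (target n (f n)))
  (thetas_max : forall n : nat, (0 < n)%N ->
    forall theta : 'rV[R]_(d n),
      target n (f n) theta <= target n (f n) (thetas n))
  (kappa_gt0 : 0 < kappa) (kappa_lt1 : kappa < 1)
  (d_le : forall n : nat, (0 < n)%N -> (d n)%:R <= n%:R `^ kappa)
  (delta0_gt0 : 0 < delta0) (lambda0_gt0 : 0 < lambda0)
  (fs_gt0 : 0 < fs) (I0_gt0 : 0 < I0)
  (f_strongly_convex : \forall n \near \oo,
    inv_strongly_convex lambda0
      [set theta | norm2 (theta - thetas n) <= delta0] (f n))
  (f_strict_optimality : \forall n \near \oo,
    ((f n (thetas n) + fs)%:E <=
     ereal_inf [set (f n (thetas n + v))%:E | v in
                 [set v : 'rV[R]_(d n) | (delta0 < norm2 v)%R]])%E)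
  (f_integral_control : \forall n \near \oo,
    (\int[lebesgue_rV (d n)]_(v in [set v | (delta0 < norm2 v)%R])
       (expR (- (f n (thetas n + v) - f n (thetas n))))%:E
     <= ((I0 * n%:R) ^+ d n)%:E)%E) :
  forall c : R, 0 < c -> c <= 1 ->
  \forall n \near \oo,
    (1 + c)^-1 * (n%:R / (2 * pi * lambda0)) `^ ((d n)%:R / 2)
      <= target n (f n) (thetas n)
    /\
    forall q : 'rV[R]_(d n) -> 'rV[R]_(d n) -> R,
      (forall theta : 'rV[R]_(d n), is_density (q theta)) ->
    forall B : R, (forall theta' theta : 'rV[R]_(d n), q theta' theta <= B) ->
    (mh_acceptance_probability (target n (f n)) q (thetas n)
      <= (B * (1 + c) * (2 * pi * lambda0 / n%:R) `^ ((d n)%:R / 2))%:E)%E.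
Proof.
move=> c c0 c1; near=> n.
have n0 : (0 < n)%N by near: n; exact: nbhs_infty_gt.
have nR0 : 0 < n%:R :> R by rewrite ltr0n.
have densn := target_density n n0; have [_ t0 _] := densn.
pose P := (2 * pi * lambda0 / n%:R) `^ ((d n)%:R / 2).
have twopi0 : 0 < 2 * pi * lambda0 :> R by rewrite !mulr_gt0// pi_gt0.
have P0 : 0 < P by rewrite powR_gt0// divr_gt0.
have PV : (n%:R / (2 * pi * lambda0)) `^ ((d n)%:R / 2) = P^-1.
  have y0 : 0 <= 2 * pi * lambda0 / n%:R by rewrite divr_ge0// ltW.
  by rewrite -invf_div -(powR_inv1 y0) powRAC powR_inv1 ?powR_ge0.
have target0 : 0 < target n (f n) (thetas n).
  by rewrite /target mulr_gt0 ?expR_gt0// invr_gt0 fine_partition_fun_gt0.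
have near_growth v : norm2 v <= delta0 ->
    norm2 v ^+ 2 / (2 * lambda0) <= f n (thetas n + v) - f n (thetas n).
  apply: strong_convexity_growth => //; first exact: ltW.
    by near: n.
  by move=> theta; rewrite -(le_target n0 densn); exact: thetas_max.
have far_growth v : delta0 < norm2 v ->
    fs <= f n (thetas n + v) - f n (thetas n).
  move=> dv; rewrite lerBrDl -lee_fin.
  apply: (@le_trans _ _ (ereal_inf [set (f n (thetas n + v))%:E | v in
                 [set v : 'rV[R]_(d n) | (delta0 < norm2 v)%R]])).
    by near: n.
  by apply: ereal_inf_lbound; exists v.
have mshift : measurable_fun [set: 'rV[R]_(d n)]
    (fun v => f n (thetas n + v) - f n (thetas n)).
  apply: measurable_funB => //.
  apply: measurableT_comp (measurable_energy n0 densn) _.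
  apply: measurable_fun_rV => i; under eq_fun do rewrite mxE.
  by apply: measurable_funD; [exact: measurable_cst|exact: measurable_coord].
(* The mass of the ball is at most P, and that of its complement at most c P. *)
have inv_target : (target n (f n) (thetas n))^-1 <= (1 + c) * P.
  rewrite -lee_fin -(integral_shifted_energy n0 densn).
  apply: le_trans (laplace_integral_le n0 lambda0_gt0 mshift near_growth
    far_growth (T := (I0 * n%:R) ^+ d n) _) _.
    by near: n.
  rewrite lee_fin [leRHS]mulrDl mul1r lerD2l.
  rewrite /P; near: n; exact: tail_negligible d_le.
have c10 : 0 < 1 + c by rewrite addr_gt0.
split.
  rewrite PV -invfM -[leRHS]invrK lef_pV2// posrE; first exact: mulr_gt0.
  by rewrite invr_gt0.
move=> q densq B qB.
have q0 y z : 0 <= q y z by have [] := densq y.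
apply: le_trans (acceptance_probability_le densn target0 q0 qB) _.
rewrite lee_fin -mulrA ler_wpM2l//.
exact: le_trans (q0 (thetas n) (thetas n)) (qB _ _).
Unshelve. all: by end_near. Qed.
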